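(* Let $(x_n)_n$ be a frame for a Hilbert space $H$ with the analysis operator $U$ and the canonical dual $(y_n)_n$. Suppose that the set of indices $E=\{1,2,\ldots,k\}$, $k\in\mathbb N$, satisfies the minimal redundancy condition for $(x_n)_n$. Let $\overline{y}_1,\ldots,\overline{y}_k$ be defined by $$\overline{y}_1=y_1,\qquad \overline{y}_n=(I-\theta_{\overline{y}_{n-1},x_{n-1}})^{-1}\cdots(I-\theta_{\overline{y}_1,x_1})^{-1}y_n,\quad n=2,\ldots,k.$$ Then $\overline{y}_1,\ldots,\overline{y}_k$ are well defined (i.e. the inverses involved exist) and $$\Bigl(I-\sum_{i=1}^n\theta_{y_i,x_i}\Bigr)^{-1}=(I-\theta_{\overline{y}_{n},x_{n}})^{-1}\cdots(I-\theta_{\overline{y}_1,x_1})^{-1},\qquad n=1,\ldots,k.$$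
   Context: Convention: $H$ is a complex Hilbert space with inner product linear in the first argument; sequences $(x_n)_n$ are indexed by a set $J$, where either $J=\mathbb{N}=\{1,2,\ldots\}$ and $H$ is infinite-dimensional and separable, or $J=\{1,\ldots,M\}$ for some $M\in\mathbb N$ and $H$ is finite-dimensional. For $x,y\in H$, $\theta_{y,x}$ is the operator on $H$ given by $\theta_{y,x}(v)=\langle v,x\rangle y$. The sequence $(x_n)_n$ is a frame for $H$ if there are constants $A,B>0$ with $A\|x\|^2\le\sum_{n}|\langle x,x_n\rangle|^2\le B\|x\|^2$ for all $x\in H$. Its analysis operator is $U:H\to\ell^2(J)$, $Ux=(\langle x,x_n\rangle)_n$; the frame operator $U^*U$ is invertible, and the canonical dual is the frame $(y_n)_n$, $y_n=(U^*U)^{-1}x_n$. A finite set of indices $E\subseteq J$ satisfies the minimal redundancy condition for $(x_n)_n$ if $\overline{\mathrm{span}}\{x_n: n\in J\setminus E\}=H$. *)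

(* Defs.v *)
From HB Require Import structures.
From mathcomp Require Import all_boot all_order all_algebra sesquilinear.
From mathcomp Require Import complex.
From mathcomp Require Import all_classical all_reals all_analysis.

Set Implicit Arguments.
Unset Strict Implicit.
Unset Printing Implicit Defensive.

Import Order.TTheory GRing.Theory Num.Theory Num.Def.
Import numFieldNormedType.Exports.

Local Open Scope classical_set_scope.
Local Open Scope ring_scope.

Section Span.
Variables (K : nzRingType) (V : lmodType K).

Definition lin_span (A : set V) : set V :=
  [set v | exists (m : nat) (a : 'I_m -> K) (u : 'I_m -> V),
     (forall i, A (u i)) /\ v = \sum_(i < m) a i *: u i].

Definition finite_dim := exists s : seq V, lin_span [set` s] = setT.

End Span.

Definition separable (T : topologicalType) :=
  exists D : set T, countable D /\ dense D.

Section Operators.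
Variables (K : numFieldType) (V : normedModType K).

Definition is_op_inverse (T S : V -> V) :=
  [/\ linear S, continuous S, T \o S = idfun & S \o T = idfun].

Definition op_invertible (T : V -> V) := exists S, is_op_inverse T S.

(* The junk value [0] is taken only when [T] has no bounded linear inverse. *)
Definition op_inv (T : V -> V) : V -> V := xget 0 [set S | is_op_inverse T S].

End Operators.

Section SquareSummable.
Variables (R : realType).

(* [complex.Re `|z|] is the modulus of [z] as an element of [R]: the norm on
   [R[i]], and on normed spaces over it, takes its values in [R[i]]. *)
Definition rnorm (V : normedZmodType R[i]) (v : V) : R := complex.Re `|v|.

(* [ell^2(J)], as the sequences on [nat] that vanish outside [J]. *)
Definition ell2 (J : set nat) : set (nat -> R[i]) :=
  [set c : nat -> R[i] | (forall n, ~ J n -> c n = 0) /\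
           (\esum_(n in J) (rnorm (c n) ^+ 2)%:E < +oo)%E].

Definition ell2_dot (c d : nat -> R[i]) : R[i] :=
  limn (series (fun n => c n * (d n)^* : R[i]^o)).

End SquareSummable.

Section Frames.
Variables (R : realType) (H : completeNormedModType R[i]).
Variables (dot : {dot H for conjC}).
Implicit Types (x y : nat -> H) (J E : set nat).

Definition index_set_for J :=
  [/\ J = [set n | (0 < n)%N], ~ finite_dim H & separable H] \/
  exists M, [/\ (0 < M)%N, J = [set n | (0 < n <= M)%N] & finite_dim H].

Definition theta (b a : H) : H -> H := fun v => dot v a *: b.

Definition is_frame J x :=
  exists A B : R, [/\ 0 < A, 0 < B &
    forall v : H,
      ((A * rnorm v ^+ 2)%:E <= \esum_(n in J) (rnorm (dot v (x n)) ^+ 2)%:E)%E /\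
      (\esum_(n in J) (rnorm (dot v (x n)) ^+ 2)%:E <= (B * rnorm v ^+ 2)%:E)%E].

Definition analysis_op J x (v : H) : nat -> R[i] :=
  fun n => if n \in J then dot v (x n) else 0.

Definition is_adjoint J (U : H -> nat -> R[i]) (W : (nat -> R[i]) -> H) :=
  forall v c, ell2 J c -> ell2_dot (U v) c = dot v (W c).

(* The defining property determines the values on [ell2 J] only. *)
Definition adjoint J (U : H -> nat -> R[i]) : (nat -> R[i]) -> H :=
  xget (fun=> 0) [set W | is_adjoint J U W].

Definition frame_op J x : H -> H :=
  adjoint J (analysis_op J x) \o analysis_op J x.

Definition canonical_dual J x : nat -> H :=
  fun n => op_inv (frame_op J x) (x n).

Definition minimal_redundancy J x E :=
  [/\ finite_set E, E `<=` J & closure (lin_span (x @` (J `\` E))) = setT].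

(* [inv_chain x z m] is
   [(I - theta_{z_m,x_m})^-1 ... (I - theta_{z_1,x_1})^-1]. *)
Fixpoint inv_chain x z (m : nat) : H -> H :=
  if m is m'.+1 then op_inv (idfun - theta (z m) (x m)) \o inv_chain x z m'
  else idfun.

End Frames.

(* Main.v *)
(** Write [G_n] for [I - sum_(i <= n) theta_{y_i,x_i}] and [S] for the frame
    operator. If [G_n v = 0], applying [S] gives
    [S v = sum_(i <= n) <v,x_i> x_i], so that [<v,S v>] is only the part [i <= n]
    of the sum [sum_i |<v,x_i>|^2]; hence [v] is orthogonal to every [x_m] with
    [m > n], and minimal redundancy forces [v = 0]. So every [G_n] is injective.

    On the other hand [G_n = G_(n-1) (I - theta_{b,x_n})] with
    [b = G_(n-1)^-1 y_n], which is [ybar_n] by induction. The last factor is thus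
    injective, i.e. [<b,x_n> <> 1], and a rank-one perturbation of the identity
    satisfying this has an explicit bounded inverse. *)
Require Import Defs.
From HB Require Import structures.
From mathcomp Require Import all_boot all_order all_algebra sesquilinear.
From mathcomp Require Import complex.
From mathcomp Require Import all_classical all_reals all_analysis.
From mathcomp Require Import ring.

Set Implicit Arguments.
Unset Strict Implicit.
Unset Printing Implicit Defensive.

Import Order.TTheory GRing.Theory Num.Theory Num.Def.
Import numFieldNormedType.Exports.

Local Open Scope classical_set_scope.
Local Open Scope ring_scope.

(** * Bounded inverses *)

Section OpInverse.
Variables (K : numFieldType) (V : normedModType K).
Implicit Types T S : V -> V.

Lemma is_op_inverse_unique T S S' :
  is_op_inverse T S -> is_op_inverse T S' -> S = S'.
Proof.
move=> [_ _ _ ST] [_ _ TS' _].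
by rewrite -[S]/(S \o idfun) -TS' compA ST.
Qed.

Lemma op_inv_unique T S : is_op_inverse T S -> op_inv T = S.
Proof.
move=> TS; apply: xget_unique => // S' TS'.
exact: is_op_inverse_unique TS' TS.
Qed.

Lemma op_invP T : op_invertible T -> is_op_inverse T (op_inv T).
Proof. exact: xgetPex. Qed.

Lemma is_op_inverse_id : is_op_inverse (idfun : V -> V) idfun.
Proof. by split=> // v; exact: cvg_id. Qed.

Lemma is_op_inverse_comp T1 T2 S1 S2 :
  is_op_inverse T1 S1 -> is_op_inverse T2 S2 ->
  is_op_inverse (T1 \o T2) (S2 \o S1).
Proof.
move=> [lS1 cS1 TS1 ST1] [lS2 cS2 TS2 ST2]; split.
- by move=> a u v /=; rewrite lS1 lS2.
- by move=> v; apply: continuous_comp; [exact: cS1|exact: cS2].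
- by rewrite compA -(compA T1) TS2.
- by rewrite compA -(compA S2) ST1.
Qed.

(** Linearity passes from the inverse back to [T]; this is how the frame operator and the partial
    operators [G n] are known to be linear. *)
Lemma linear_op_inverse T S : is_op_inverse T S -> linear T.
Proof.
move=> [lS _ TS ST] a u v.
have TSE w : T (S w) = w by exact: (congr1 (@^~ w) TS).
have STE w : S (T w) = w by exact: (congr1 (@^~ w) ST).
by rewrite -[RHS]TSE lS !STE.
Qed.

End OpInverse.

(** * Rank-one operators *)

Section Theta.
Variables (R : realType) (H : completeNormedModType R[i]).
Variables (dot : {dot H for conjC}).

Lemma theta_is_linear (b a : H) : linear (theta dot b a).
Proof.
by move=> k u v; rewrite /theta linearDl linearZl_LR scalerDl scalerA.
Qed.

HB.instance Definition _ b a :=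
  @GRing.isLinear.Build R[i] H H _ (theta dot b a) (theta_is_linear b a).

Hypothesis dot_norm : forall v : H, dot v v = `|v| ^+ 2.

Lemma dot_CauchySchwarz (u v : H) : `|dot u v| <= `|u| * `|v|.
Proof.
rewrite -(@ler_pXn2r _ 2) ?nnegrE ?mulr_ge0// exprMn -!dot_norm.
have [->|v0] := eqVneq v 0.
  by rewrite linear0r normr0 expr0n (linear0r dot 0) mulr0.
have vv0 : 0 < dot v v by rewrite dnorm_gt0.
(* [w] is the component of [u] orthogonal to [v], so Pythagoras applies to [u = w + c *: v]. *)
pose c := dot u v / dot v v; pose w := u - c *: v.
have wv0 : dot w v = 0.
  by rewrite linearBl linearZl_LR /= divfK ?subrr// gt_eqF.
have -> : dot u u = dot w w + `|c| ^+ 2 * dot v v.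
  by rewrite -dnormZ -hnormDd ?subrK// linearZr_LR /= wv0 mulr0.
rewrite normrM normfV (gtr0_norm vv0) exprMn mulrDl.
rewrite -mulrA -mulrA -expr2 -exprMn mulVf ?gt_eqF// expr1n mulr1.
by rewrite lerDr mulr_ge0 ?dnorm_ge0.
Qed.

Lemma theta_continuous (b a : H) : continuous (theta dot b a).
Proof.
apply: bounded_linear_continuous; apply/linear_boundedP.
near=> r => v; rewrite /theta normrZ.
apply: (@le_trans _ _ (`|v| * `|a| * `|b|)).
  by rewrite ler_wpM2r// dot_CauchySchwarz.
by rewrite -mulrA mulrC ler_wpM2r.
Unshelve. all: by end_near. Qed.

Lemma op_invertible_sub_theta (b a : H) : dot b a != 1 ->
  op_invertible (idfun - theta dot b a).
Proof.
move=> ba; have d0 : 1 - dot b a != 0 by rewrite subr_eq0 eq_sym.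
(* Sherman-Morrison formula: [theta dot b a] squares to [dot b a] times itself, so the inverse is
   the identity plus a multiple of it. *)
exists (idfun + theta dot ((1 - dot b a)^-1 *: b) a); split.
- exact: linearP.
- move=> v; apply: continuousD; [exact: cvg_id|exact: theta_continuous].
- apply/funext => v; rewrite /= !fctE /theta /= linearDl !linearZl_LR /=.
  rewrite !scalerA -addrA -scalerBl -[RHS]addr0; congr (_ + _).
  by apply/eqP; rewrite scaler_eq0; apply/orP; left; apply/eqP; field.
- apply/funext => v; rewrite /= !fctE /theta /= linearBl linearZl_LR /=.
  rewrite scalerA -addrA -scaleNr -scalerDl -[RHS]addr0; congr (_ + _).
  by apply/eqP; rewrite scaler_eq0; apply/orP; left; apply/eqP; field.
Qed.

(** * Square-summable sequences *)

Lemma limn_realc (u : R ^nat) : cvgn u ->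
  limn (fun n => (u n)%:C%C : R[i]^o) = (limn u)%:C%C.
Proof.
move=> cu; apply/cvg_lim; first exact: norm_hausdorff.
apply/cvgrPdist_lt => e e0.
have /complex_realP[r rE] := gtr0_real e0.
move: e0; rewrite {}rE ltcR => r0.
move/cvgrPdist_lt : cu => /(_ r r0); apply: filterS => n ltr.
by rewrite -rmorphB/= normc_def/= expr0n addr0 sqrtr_sqr ltcR.
Qed.

Lemma sum_le_ell2_dot (J : set nat) c N : ell2 J c ->
  \sum_(0 <= i < N) `|c i| ^+ 2 <= ell2_dot c c :> R[i].
Proof.
move=> [cJ fin].
pose r n := rnorm (c n) ^+ 2.
have rE n : c n * (c n)^* = (r n)%:C%C.
  by rewrite -normCK rmorphXn/= RRe_real ?normr_real.
have r_ge0 n : 0 <= r n by exact: exprn_even_ge0.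
have ncE : series (fun n => c n * (c n)^* : R[i]^o) =
    fun n => (series r n)%:C%C.
  apply/funext => n; rewrite /series /= rmorph_sum/=.
  by apply: eq_bigr => i _; exact: rE.
have ndr : {homo series r : n m / (n <= m)%N >-> n <= m}.
  by apply/nondecreasing_series.
have cvr : cvgn (series r).
  apply: nondecreasing_is_cvgn => //.
  (* Partial sums run over all of [nat], but [c] vanishes outside [J], so the sum over [J] bounds
     them. *)
  exists (fine (\esum_(n in J) (r n)%:E)) => _ [n _ <-].
  have JE : [set i | i \in J] = J by apply/funext => i /=; rewrite in_setE.
  rewrite -lee_fin fineK; last first.
    by rewrite ge0_fin_numE// esum_ge0// => i _; rewrite lee_fin.
  rewrite -{1}JE -nneseries_esum; last by move=> i _; rewrite lee_fin.
  apply: le_trans (nneseries_lim_ge n _); last by move=> *; rewrite lee_fin.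
  rewrite sumEFin lee_fin [leRHS]big_mkcond /series /=.
  apply: ler_sum => i _; case: ifPn => //; rewrite notin_setE => /cJ ci0.
  by rewrite /r ci0 /rnorm normr0 expr0n.
rewrite /ell2_dot ncE limn_realc//.
have -> : \sum_(0 <= i < N) `|c i| ^+ 2 = (series r N)%:C%C.
  by rewrite rmorph_sum; apply: eq_bigr => i _; rewrite normCK rE.
by rewrite lecR; exact: nondecreasing_cvgn_le.
Qed.

(** * The frame operator and injectivity *)

Lemma ell2_analysis_op J x v :
  is_frame dot J x -> ell2 J (analysis_op dot J x v).
Proof.
move=> [A [B [_ _ /(_ v)[_ vB]]]]; split.
  by move=> n Jn; rewrite /analysis_op memNset.
apply: le_lt_trans (ltry (B * rnorm v ^+ 2)); apply: le_trans vB.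
by apply: le_esum => n Jn; rewrite /analysis_op mem_set.
Qed.

(** If [v] were nonzero, some [w] in the span would lie closer to [v] than [0] does; but [w] is
    orthogonal to [v], so its distance to [v] is at least the norm of [v]. *)
Lemma dot_dense_eq0 (A : set H) v : closure (lin_span A) = setT ->
  (forall u, A u -> dot v u = 0) -> v = 0.
Proof.
move=> dA vA; apply/eqP; apply: contraT => v0.
have : closure (lin_span A) v by rewrite dA.
move=> /(_ (ball v `|v|)) []; first by apply: nbhsx_ballx; rewrite normr_gt0.
move=> _ [[m [a [u [Au ->]]]]]; rewrite -ball_normE /=.
set w := \sum_(i < m) _; have vw : dot v w = 0.
  by rewrite linear_sumr big1// => i _; rewrite linearZr_LR/= vA ?mulr0.
rewrite -(@ltr_pXn2r _ 2) ?nnegrE// -!dot_norm hnormBd//.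
by rewrite le_gtF// lerDl dnorm_ge0.
Qed.

Lemma frame_op_dot J x v :
  (exists W, is_adjoint dot J (analysis_op dot J x) W) -> is_frame dot J x ->
  dot v (frame_op dot J x v) =
    ell2_dot (analysis_op dot J x v) (analysis_op dot J x v).
Proof.
move=> /(xgetPex (fun=> 0)) adj hx; rewrite /frame_op /= /adjoint adj//.
exact: ell2_analysis_op.
Qed.

Lemma frame_theta_sum_inj J x y k n v : is_frame dot J x ->
  minimal_redundancy J x [set i | (0 < i <= k)%N] ->
  (forall i, J i -> y i = canonical_dual dot J x i) -> (n <= k)%N ->
  v = \sum_(1 <= i < n.+1) theta dot (y i) (x i) v -> v = 0.
Proof.
move=> hx [_ EkJ dE] hy nk hv.
have EnEk i : (0 < i <= n)%N -> (0 < i <= k)%N.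
  by move=> /andP[-> /leq_trans]; exact.
have EJ i : (0 < i <= n)%N -> J i by move=> /EnEk; exact: EkJ.
(* If [frame_op] has no bounded inverse, the [y i] take the junk value [0].
   This and the next case never occur for a frame, but covering them is easier
   than proving that the adjoint exists and the frame operator is invertible. *)
have [/op_invP|ninv] := pselect (op_invertible (frame_op dot J x)); last first.
  rewrite hv big_nat big1// => i /andP[i1 ik].
  rewrite /theta hy; last by apply: EJ; rewrite i1.
  rewrite /canonical_dual /op_inv xgetPN ?scaler0// => S invS.
  by apply: ninv; exists S.
move=> invS; have linS := linear_op_inverse invS; case: invS => _ _ ST TS.
set T := op_inv _ in ST TS; set S := frame_op dot J x in linS ST TS.
have TSE w : T (S w) = w by exact: (congr1 (@^~ w) TS).
have STE w : S (T w) = w by exact: (congr1 (@^~ w) ST).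
(* Without an adjoint, [S] is the junk value [0]; being invertible, it then
   lives on the zero space. *)
have [adj|nadj] :=
  pselect (exists W, is_adjoint dot J (analysis_op dot J x) W); last first.
  have S0 w : S w = 0.
    rewrite /S /frame_op /= /adjoint xgetPN// => W adjW.
    by apply: nadj; exists W.
  by rewrite -(STE v) S0.
pose SL := @GRing.isLinear.Build R[i] H H _ S linS.
pose SF : {linear H -> H} := HB.pack S SL.
have Sv : S v = \sum_(1 <= i < n.+1) dot v (x i) *: x i.
  rewrite {1}hv -[S]/(SF : H -> H) linear_sum [LHS]big_nat [RHS]big_nat.
  apply: eq_bigr => i /andP[i1 ik]; rewrite linearZ /= hy ?STE//.
  by apply: EJ; rewrite i1.
set c := analysis_op dot J x v.
have cE i : J i -> c i = dot v (x i).
  by move=> Ji; rewrite /c /analysis_op mem_set.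
have dotc : ell2_dot c c = \sum_(1 <= i < n.+1) `|c i| ^+ 2.
  rewrite -frame_op_dot// -/S Sv linear_sumr [LHS]big_nat [RHS]big_nat.
  apply: eq_bigr => i /andP[i1 ik]; rewrite linearZr_LR/= cE ?normCK 1?mulrC//.
  by apply: EJ; rewrite i1.
apply: dot_dense_eq0 dE _ => _ [m [Jm /= nEm] <-].
rewrite -cE//; apply/eqP; rewrite -normr_eq0 -sqrf_eq0 eq_le exprn_ge0// andbT.
(* This partial sum reaches both [m] and [n]. By [dotc] its terms of index 1 to [n] already exhaust
   the total, so the others, among them that of [m], add up to at most 0. *)
have := sum_le_ell2_dot (maxn m n).+1 (ell2_analysis_op v hx).
rewrite -/c dotc.
rewrite (big_nat_widen 1 n.+1 (maxn m n).+1) ?ltnS ?leq_maxr//=.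
rewrite (big_nat_widenl 1 0)//= (bigID (fun i => 0 < i <= n)%N)/=.
under [X in _ <= X -> _]eq_bigl do rewrite ltnS andbC.
rewrite gerDl; apply: le_trans.
rewrite -big_filter (bigD1_seq m) ?filter_uniq ?iota_uniq//.
  by rewrite lerDl sumr_ge0// => i _; rewrite exprn_ge0.
rewrite mem_filter mem_index_iota ltnS leq_maxl !andbT.
by apply/negP => /EnEk.
Qed.

(** * Factorization into rank-one perturbations *)

Section RankOneChain.
Variables (x y ybar : nat -> H) (k : nat).
Hypothesis ybarE : forall n, (n < k)%N ->
  ybar n.+1 = inv_chain dot x ybar n (y n.+1).

Let G n : H -> H := idfun - \sum_(1 <= i < n.+1) theta dot (y i) (x i).

Hypothesis kerG : forall n v, (n <= k)%N -> G n v = 0 -> v = 0.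

Lemma partial_theta_factor n : (n < k)%N ->
  is_op_inverse (G n) (inv_chain dot x ybar n) ->
  G n.+1 = G n \o (idfun - theta dot (ybar n.+1) (x n.+1)).
Proof.
move=> nk inv; have linG := linear_op_inverse inv; case: inv => _ _ GI _.
apply/funext => v /=.
have GIE : G n (ybar n.+1) = y n.+1.
  by rewrite ybarE//; exact: (congr1 (@^~ (y n.+1)) GI).
pose GL : {linear H -> H} :=
  HB.pack (G n) (GRing.isLinear.Build _ _ _ _ _ linG).
rewrite [RHS](_ : _ = GL (v - dot v (x n.+1) *: ybar n.+1))//.
rewrite linearB linearZ /= GIE /G big_nat_recr//= opprD addrA.
by rewrite /theta !fctE.
Qed.

Lemma op_invertible_chain_factor n : (n < k)%N ->
  is_op_inverse (G n) (inv_chain dot x ybar n) ->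
  op_invertible (idfun - theta dot (ybar n.+1) (x n.+1)).
Proof.
move=> nk inv; apply: op_invertible_sub_theta; apply/eqP => d1.
(* The factor kills [ybar n.+1], hence so does [G n.+1]; injectivity makes this vector 0, against
   [d1]. *)
have Iy0 : (idfun - theta dot (ybar n.+1) (x n.+1)) (ybar n.+1) = 0.
  by rewrite !fctE /theta d1 scale1r subrr.
have y0 : ybar n.+1 = 0.
  apply: (kerG nk); rewrite partial_theta_factor// /comp Iy0.
  have := linear_op_inverse inv (-1) 0 0.
  by rewrite scaler0 addr0 scaleN1r addNr.
by move/eqP: d1; rewrite y0 linear0l eq_sym oner_eq0.
Qed.

(** Existence and formula go through one induction: the inverse of [G n] is what yields
    invertibility of the next factor. *)
Lemma inv_chain_is_op_inverse n : (n <= k)%N ->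
  is_op_inverse (G n) (inv_chain dot x ybar n).
Proof.
elim: n => [|n IH] nk.
  by rewrite /G big_geq// subr0; exact: is_op_inverse_id.
have invn := IH (ltnW nk); rewrite partial_theta_factor//.
apply: is_op_inverse_comp => //; apply: op_invP.
exact: op_invertible_chain_factor.
Qed.

End RankOneChain.

End Theta.

Theorem theorem3p4 (R : realType) (H : completeNormedModType R[i])
    (dot : {dot H for conjC})
    (dot_norm : forall v : H, dot v v = `|v| ^+ 2)
    (J : set nat) (hJ : index_set_for H J)
    (x : nat -> H) (hx : is_frame dot J x)
    (k : nat) (hk : (0 < k)%N)
    (hE : minimal_redundancy J x [set n | (0 < n <= k)%N])
    (y : nat -> H) (hy : forall n, J n -> y n = canonical_dual dot J x n)
    (ybar : nat -> H)
    (ybar1 : ybar 1%N = y 1%N)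
    (ybarS : forall n, (2 <= n <= k)%N ->
       ybar n = inv_chain dot x ybar n.-1 (y n)) :
  (forall n, (0 < n <= k)%N ->
     op_invertible (idfun - theta dot (ybar n) (x n))) /\
  (forall n, (0 < n <= k)%N ->
     op_invertible (idfun - \sum_(1 <= i < n.+1) theta dot (y i) (x i)) /\
     op_inv (idfun - \sum_(1 <= i < n.+1) theta dot (y i) (x i)) =
       inv_chain dot x ybar n).
Proof.
have ybarE n : (n < k)%N -> ybar n.+1 = inv_chain dot x ybar n (y n.+1).
  (* The chain of length 0 is the identity, so [ybar1] is the case [n = 0] of the recursion. *)
  by case: n => [|n] nk; [exact: ybar1 | exact: ybarS].
have kerG n v : (n <= k)%N ->
    (idfun - \sum_(1 <= i < n.+1) theta dot (y i) (x i)) v = 0 -> v = 0.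
  move=> nk /eqP; rewrite !fctE subr_eq0 => /eqP hv.
  apply: (frame_theta_sum_inj dot_norm hx hE hy nk).
  by move: hv; rewrite fct_sumE.
have inv := inv_chain_is_op_inverse dot_norm ybarE kerG.
split=> -[//|n] /= nk.
  exact: (op_invertible_chain_factor dot_norm ybarE kerG nk (inv _ (ltnW nk))).
split; last exact/op_inv_unique/inv.
by exists (inv_chain dot x ybar n.+1); exact: inv.
Qed.
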